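(* Let $\alpha\in(0,1]$ and $R\in(0,1)$. Then the function $$x=\sum_{m=0}^\infty 2^{(\frac12-\alpha R)m}\sum_{k=0}^{\lfloor2^{\alpha m}\rfloor-1}e_{m,k}$$ on $[0,1]$ admits the roughness exponent $R$. On the other hand, with $\gamma:=\alpha R+(1-\alpha)/2$, $$\lim_{n\uparrow\infty}2^{n(2\gamma-1)}\langle x\rangle_n^{(2)}=\big(2^{2-2\gamma}-1\big)^{-1}\qquad\text{and}\qquad\lim_{n\uparrow\infty}\widehat R_n(x)=\gamma.$$
   Context: The Faber--Schauder functions are $e_{0,0}(t):=(\min\{t,1-t\})^+$ and $e_{m,k}(t):=2^{-m/2}e_{0,0}(2^mt-k)$ for $m\in\mathbb N_0$, $k\in\mathbb Z$. For $x\in C[0,1]$ nonconstant, $p>0$ and $n\in\mathbb N$, let $\langle x\rangle_n^{(p)}:=\sum_{k=0}^{2^n-1}|x((k+1)2^{-n})-x(k2^{-n})|^p$. The function $x$ admits the roughness exponent $R:=1/q$ if there exists $q\in[1,\infty]$ such that $\lim_{n}\langle x\rangle_n^{(p)}=0$ for every $p>q$ and $\lim_n\langle x\rangle_n^{(p)}=\infty$ for every $0<p<q$ (with $1/\infty:=0$). The Faber--Schauder coefficients of $x$ are $\theta_{m,k}:=2^{m/2}\big(2x(\tfrac{2k+1}{2^{m+1}})-x(\tfrac{k}{2^m})-x(\tfrac{k+1}{2^m})\big)$ for $m\in\mathbb N_0$, $k=0,\dots,2^m-1$; $s_n:=\sqrt{\sum_{m=0}^{n-1}\sum_{k=0}^{2^m-1}\theta_{m,k}^2}$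 and $\widehat R_n(x):=1-\frac1n\log_2 s_n$ for $n\in\mathbb N$. *)

(* Defs.v *)
From HB Require Import structures.
From mathcomp Require Import all_boot all_order all_algebra.
From mathcomp Require Import all_classical all_reals all_analysis.
Set Implicit Arguments.
Unset Strict Implicit.
Unset Printing Implicit Defensive.
Import Order.TTheory GRing.Theory Num.Theory.
Import numFieldNormedType.Exports.
Local Open Scope classical_set_scope.
Local Open Scope ring_scope.

(* A function on [0, 1] is represented by a total function R -> R; every notion
   below depends only on its values on [0, 1]. *)

Section FaberSchauder.
Context {R : realType}.
Implicit Types (x : R -> R) (p r t : R) (m n : nat).

Definition fs00 t : R := Num.max (Num.min t (1 - t)) 0.

Definition fs m (k : int) t : R :=
  2 `^ (- (m%:R / 2)) * fs00 (2 ^+ m * t - k%:~R).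

Definition pvariation x p n : R :=
  \sum_(0 <= k < 2 ^ n) `|x (k.+1%:R / 2 ^+ n) - x (k%:R / 2 ^+ n)| `^ p.

(* The inverse of extended reals is used for r = 1 / q, so that q = +oo
   corresponds to r = 0. *)
Definition admits_roughness_exponent x r : Prop :=
  [/\ {within `[0 : R, 1 : R], continuous x},
      exists s t : R, [/\ s \in `[0, 1], t \in `[0, 1] & x s != x t]
    & exists q : \bar R, [/\ (1 <= q)%E,
        (r%:E = q^-1)%E,
        forall p, 0 < p -> (q < p%:E)%E ->
          pvariation x p n @[n --> \oo] --> (0 : R)
      & forall p, 0 < p -> (p%:E < q)%E ->
          pvariation x p n @[n --> \oo] --> +oo]].

Definition fs_coef x m k : R :=
  2 `^ (m%:R / 2) *
  (2 * x ((2 * k + 1)%:R / 2 ^+ m.+1) - x (k%:R / 2 ^+ m)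
   - x (k.+1%:R / 2 ^+ m)).

Definition fs_norm x n : R :=
  Num.sqrt (\sum_(0 <= m < n) \sum_(0 <= k < 2 ^ m) fs_coef x m k ^+ 2).

Definition log2 t : R := ln t / ln 2.

Definition roughness_estimator x n : R := 1 - n%:R^-1 * log2 (fs_norm x n).

(* Num.truncn is the floor of a nonnegative real, as a nat. *)
Definition sparse_fs_term (alpha rho : R) t m : R :=
  2 `^ ((2^-1 - alpha * rho) * m%:R) *
  \sum_(0 <= k < Num.truncn (2 `^ (alpha * m%:R))) fs m k%:Z t.

Definition sparse_fs (alpha rho : R) t : R :=
  limn (series (sparse_fs_term alpha rho t)).

End FaberSchauder.

(* Main.v *)
Require Import Defs.
From HB Require Import structures.
From mathcomp Require Import all_boot all_order all_algebra.
From mathcomp Require Import all_classical all_reals all_analysis.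
From mathcomp Require Import ring lra zify.
Import Order.TTheory GRing.Theory Num.Theory.
Import numFieldNormedType.Exports.
Local Open Scope classical_set_scope.
Local Open Scope ring_scope.

(**
Write K_m for the integer part of 2^(alpha m), r := 2^(- alpha rho) and

  D_(n,k) := 2 x((2k+1)/2^(n+1)) - x(k/2^n) - x((k+1)/2^n)

for the excess of x at the midpoint of a dyadic interval.  At level m the
series consists of K_m consecutive tents of height r^m / 2.  On the dyadic
grid of mesh 2^-(n+1), the levels above n vanish and the levels below n are
affine on each interval of length 2^-n, so only level n contributes to D_(n,k):
it equals r^n when k < K_n and 0 otherwise ([midpoint_excess_sparse_fs]).

Halving a dyadic interval with increment A and midpoint excess D produces the
increments (A + D) / 2 and (A - D) / 2.  Hence the p-variation satisfies a
one-step recursion driven by the sums over k of |D_(n,k)|^p, that is by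
K_n r^(np), which is comparable to 2^(n alpha (1 - rho p)).  Everything follows
from this recursion.

- For p < 1/rho: one of |A + D|, |A - D| is at least |D|, so the p-variation at
  level n + 1 is at least K_n (r^n / 2)^p, which diverges ([pvariation_ge]).
- For p > 1/rho: (|A| + |D|)^p <= (1 + s)^p |A|^p + (1 + 1/s)^p |D|^p for every
  s > 0.  As p > 1, some s makes 2^(1-p) (1 + s)^p < 1, so the p-variation
  satisfies v_(n+1) <= mu v_n + eta_n with mu < 1 and eta_n tending to 0
  ([pvariation_le], [contraction_cvg0]).
- For p = 2 the parallelogram law makes the recursion an identity: since
  x(0) = x(1), 2^n times the quadratic variation is the sum of the squared
  Faber-Schauder coefficients up to level n - 1 ([pvariation2E]).  With w := 2^(2 - 2 gamma), that sum
  divided by w^n obeys u_(n+1) = (u_n + kappa_n) / w, where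
  kappa_n := K_n 2^(- alpha n) tends to 1; so u_n tends to the fixed point
  1 / (w - 1), by [contraction_cvg0] again.  This gives the limit of the
  rescaled quadratic variation and, after taking logarithms, that of the
  roughness estimator.
*)

(** * Sequences and series *)

(** A geometrically damped recursion forgets its past: after the perturbation
has become small, the error settles at a fixed multiple of it. *)
Lemma contraction_cvg0 (R : realType) (e eta : R^nat) (mu : R) :
  0 <= mu < 1 -> (forall n, `|e n.+1| <= mu * `|e n| + eta n) ->
  eta @ \oo --> (0 : R) -> e @ \oo --> (0 : R).
Proof.
move=> /andP[mu0 mu1] He /cvgr0Pnorm_le Heta.
apply/cvgr0Pnorm_le => eps eps0.
have d0 : 0 < eps / 2 * (1 - mu) by rewrite mulr_gt0 ?subr_gt0 // divr_gt0.
have [N _ HN] := Heta _ d0.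
have Hj j : `|e (j + N)%N| <= mu ^+ j * `|e N| + eps / 2.
  elim: j => [|j IH]; first by rewrite expr0 mul1r lerDl divr_ge0 // ltW.
  rewrite addSn (le_trans (He _)) //.
  have := HN (j + N)%N (leq_addl _ _); move/(le_trans (ler_norm _)) => Hn.
  have := ler_wpM2l mu0 IH; rewrite exprS; lra.
have mu_cvg : (fun j => mu ^+ j * `|e N|) @ \oo --> (0 : R).
  rewrite -[0](mul0r `|e N|); apply: cvgMr_tmp; apply: cvg_expr.
  by rewrite ger0_norm.
have [M _ HM] := (cvgr0Pnorm_le _).1 mu_cvg _ (divr_gt0 eps0 (ltr0n _ 2)).
exists (M + N)%N => // n /= MNn.
have -> : n = (n - N + N)%N by lia.
apply: le_trans (Hj _) _; rewrite [leRHS](splitr eps) lerD2r.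
by apply: le_trans (ler_norm _) (HM _ _) => /=; lia.
Qed.

Lemma geometric_series_cvg (R : realType) (T : Type) (f : nat -> T -> R)
    (r : R) :
  0 < r < 1 -> (forall n t, `|f n t| <= r ^+ n) ->
  forall t, cvgn (series (f ^~ t)).
Proof.
move=> /andP[r0 r1] fr t; apply: normed_cvg.
apply: (series_le_cvg _ _ (fr ^~ t)) => [n|n|].
- exact: normr_ge0.
- by rewrite exprn_ge0 // ltW.
- rewrite exprn_geometric; apply: is_cvg_geometric_series.
  by rewrite gtr0_norm.
Qed.

(** The partial sums approach the limit uniformly, with error at most
r^n / (1 - r). *)
Lemma geometric_series_continuous (R : realType) (T : topologicalType)
    (f : nat -> T -> R) (r : R) :
  0 < r < 1 -> (forall n t, `|f n t| <= r ^+ n) ->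
  (forall n, continuous (f n)) ->
  continuous (fun t => limn (series (f ^~ t))).
Proof.
move=> r01 fr fc; have /andP[r0 r1] := r01.
have fcvg := geometric_series_cvg R T f r r01 fr.
have tail t n : `|limn (series (f ^~ t)) - series (f ^~ t) n| <= r ^+ n / (1 - r).
  have Hc : (fun N => `|series (f ^~ t) N - series (f ^~ t) n|) @ \oo -->
      `|limn (series (f ^~ t)) - series (f ^~ t) n|.
    by apply: cvg_norm; apply: cvgB; [exact: fcvg|exact: cvg_cst].
  rewrite -(cvg_lim _ Hc) //; apply: limr_le; first exact: cvgP Hc.
  exists n => // N /= nN; rewrite sub_series nN.
  apply: le_trans (ler_norm_sum _ _ _) _.
  apply: le_trans (ler_sum _ (fun i _ => fr i t)) _.
  rewrite -(subnKC nN) geometric_partial_tail geometric_le_lim //.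
  - by rewrite exprn_ge0 // ltW.
  - by rewrite gtr0_norm.
have Sc n : continuous (fun t => series (f ^~ t) n).
  elim: n => [|n IH] t.
    rewrite (_ : (fun _ => _) = cst 0); first exact: cvg_cst.
    by apply/funext => u; rewrite /series /= big_geq.
  rewrite (_ : (fun _ => _) = (fun u => series (f ^~ u) n + f n u)).
    by apply: cvgD; [exact: IH|exact: fc].
  by apply/funext => u; rewrite /series /= big_nat_recr.
move=> t; apply/cvgrPdist_le => eps eps0.
have rn_cvg : (fun n => r ^+ n / (1 - r)) @ \oo --> (0 : R).
  rewrite -[0](mul0r (1 - r)^-1); apply: cvgMr_tmp; apply: cvg_expr.
  by rewrite gtr0_norm.
have [n _ /(_ n (leqnn n)) /=] :=
  (cvgr0Pnorm_le _).1 rn_cvg (eps / 3) (divr_gt0 eps0 (ltr0n _ 3)).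
move=> /(le_trans (ler_norm _)) rn.
have /cvgrPdist_le/(_ (eps / 3) (divr_gt0 eps0 (ltr0n _ 3))) := Sc n t.
apply: filterS => u Hu.
have := le_trans (tail t n) rn; have := le_trans (tail u n) rn; move: Hu.
rewrite !ler_norml; lra.
Qed.

Lemma big_nat_double (R : nmodType) (F : nat -> R) n :
  \sum_(0 <= k < 2 * n) F k = \sum_(0 <= k < n) (F (2 * k)%N + F (2 * k).+1).
Proof.
elim: n => [|n IH]; first by rewrite muln0 !big_geq.
by rewrite mulnS !addSn add0n !big_nat_recr //= IH addrA.
Qed.

Lemma expr_cvgy (R : realType) (z : R) : 1 < z -> z ^+ n @[n --> \oo] --> +oo.
Proof.
move=> z1; have z0 : 0 < z by apply: lt_trans z1.
apply/gtr0_cvgV0; first by near=> n; rewrite exprn_gt0.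
under eq_cvg do rewrite /= -exprVn.
by apply: cvg_expr; rewrite gtr0_norm ?invr_gt0 // invf_lt1.
Unshelve. all: by end_near. Qed.

Lemma pow2D (R : realType) (u v : R) : 2 `^ (u + v) = 2 `^ u * 2 `^ v :> R.
Proof. by rewrite powRD // pnatr_eq0 implybT. Qed.

Lemma pow2_gt1 (R : realType) (u : R) : 0 < u -> 1 < 2 `^ u :> R.
Proof.
move=> u0; rewrite /powR pnatr_eq0 /= -[ltLHS]expR0 ltr_expR.
by rewrite mulr_gt0 // ln_gt0 // ltr1n.
Qed.

Lemma pow2_lt1 (R : realType) (u : R) : u < 0 -> 0 < (2 `^ u : R) < 1.
Proof.
move=> u0; rewrite powR_gt0 ?ltr0n // -[u]opprK powRN invf_lt1 ?powR_gt0 //.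
by rewrite pow2_gt1 // oppr_gt0.
Qed.

Lemma powR_expr (R : realType) (b u : R) n : b `^ (u * n%:R) = (b `^ u) ^+ n.
Proof. by rewrite powRrM powR_mulrn ?powR_ge0. Qed.

(** * The increments of a function along the dyadic partitions *)

Definition midpoint_excess {R : realType} (x : R -> R) m k : R :=
  2 * x ((2 * k + 1)%:R / 2 ^+ m.+1) - x (k%:R / 2 ^+ m)
  - x (k.+1%:R / 2 ^+ m).

Definition increment {R : realType} (x : R -> R) n k : R :=
  x (k.+1%:R / 2 ^+ n) - x (k%:R / 2 ^+ n).

Lemma fs_coefE (R : realType) (x : R -> R) m k :
  fs_coef x m k = 2 `^ (m%:R / 2) * midpoint_excess x m k.
Proof. by []. Qed.

Lemma dyadic_refine (R : realType) n k :
  (2 * k)%:R / 2 ^+ n.+1 = k%:R / 2 ^+ n :> R.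
Proof.
by rewrite natrM exprS -mulf_div divff ?mul1r // pnatr_eq0.
Qed.

Lemma increment_left (R : realType) (x : R -> R) n k :
  increment x n.+1 (2 * k) =
  (increment x n k + midpoint_excess x n k) / 2.
Proof.
rewrite /increment /midpoint_excess dyadic_refine addn1; lra.
Qed.

Lemma increment_right (R : realType) (x : R -> R) n k :
  increment x n.+1 (2 * k).+1 =
  (increment x n k - midpoint_excess x n k) / 2.
Proof.
rewrite /increment /midpoint_excess (_ : (2 * k).+2 = (2 * k.+1)%N); last by lia.
by rewrite dyadic_refine addn1; lra.
Qed.

Lemma pvariation_ge0 (R : realType) (x : R -> R) p n : 0 <= pvariation x p n.
Proof. by apply: sumr_ge0 => k _; exact: powR_ge0. Qed.

Lemma pvariation_refine (R : realType) (x : R -> R) p n :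
  pvariation x p n.+1 =
  \sum_(0 <= k < 2 ^ n)
    (`|(increment x n k + midpoint_excess x n k) / 2| `^ p +
     `|(increment x n k - midpoint_excess x n k) / 2| `^ p).
Proof.
rewrite /pvariation expnS.
rewrite (eq_bigr (fun k => `|increment x n.+1 k| `^ p)) // big_nat_double.
by apply: eq_bigr => k _; rewrite increment_left increment_right.
Qed.

(** New oscillation cannot be cancelled: (A + D) - (A - D) = 2 D, so one of the
two half-increments is at least |D| / 2 whatever the coarser increment A is. *)
Lemma pvariation_ge (R : realType) (x : R -> R) p n : 0 <= p ->
  \sum_(0 <= k < 2 ^ n) `|midpoint_excess x n k / 2| `^ p <=
  pvariation x p n.+1.
Proof.
move=> p0; rewrite pvariation_refine; apply: ler_sum => k _.
set A := increment x n k; set D := midpoint_excess x n k.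
have norm_le (u v : R) : `|u| <= `|v| -> `|u| `^ p <= `|v| `^ p.
  by move=> uv; rewrite ge0_ler_powR // nnegrE normr_ge0.
have tri : `|D| + `|D| <= `|A + D| + `|A - D|.
  rewrite -mulr2n -normrMn; apply: le_trans (ler_normB _ _).
  by rewrite (_ : A + D - (A - D) = D *+ 2) //; ring.
have [AD|AD] := leP `|D| `|A + D|.
- rewrite -[leLHS]addr0 lerD ?powR_ge0 // norm_le // !normrM ler_wpM2r //.
- rewrite -[leLHS]add0r lerD ?powR_ge0 // norm_le // !normrM ler_wpM2r //.
  by move: tri; lra.
Qed.

(** A substitute for the Minkowski inequality, which keeps the factor of the
first term as close to 1 as desired: compare d with s a, and bound the sum by
(1 + s) a or by (1 + 1/s) d. *)
Lemma powR_add_le (R : realType) (a d s p : R) :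
  0 <= a -> 0 <= d -> 0 < s -> 0 <= p ->
  (a + d) `^ p <= (1 + s) `^ p * a `^ p + (1 + s^-1) `^ p * d `^ p.
Proof.
move=> a0 d0 s0 p0; have si0 : 0 < s^-1 by rewrite invr_gt0.
have s1 : 0 <= 1 + s by rewrite addr_ge0 // ltW.
have s1' : 0 <= 1 + s^-1 by rewrite addr_ge0 // ltW.
rewrite -!powRM //; have [ds|sd] := leP d (s * a).
- rewrite -[leLHS]addr0 lerD ?powR_ge0 //.
  by rewrite ge0_ler_powR // ?nnegrE ?addr_ge0 ?mulr_ge0 // mulrDl mul1r lerD2l.
- rewrite -[leLHS]add0r lerD ?powR_ge0 //.
  rewrite ge0_ler_powR // ?nnegrE ?addr_ge0 ?mulr_ge0 // mulrDl mul1r addrC.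
  by rewrite lerD2l mulrC ler_pdivlMr // mulrC ltW.
Qed.

(** Refining doubles the number of increments and halves their size, whence the
factor 2^(1-p).  The parameter s trades the loss on the old increments against
the weight of the new midpoint excesses. *)
Lemma pvariation_le (R : realType) (x : R -> R) p s n : 0 <= p -> 0 < s ->
  pvariation x p n.+1 <=
  2 `^ (1 - p) * ((1 + s) `^ p * pvariation x p n +
    (1 + s^-1) `^ p * \sum_(0 <= k < 2 ^ n) `|midpoint_excess x n k| `^ p).
Proof.
move=> p0 s0; rewrite pvariation_refine.
rewrite (_ : pvariation x p n = \sum_(0 <= k < 2 ^ n) `|increment x n k| `^ p) //.
rewrite !mulr_sumr -big_split /= mulr_sumr; apply: ler_sum => k _.
set A := increment x n k; set D := midpoint_excess x n k.
have half u : `|u| <= `|A| + `|D| ->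
    `|u / 2| `^ p <= 2 `^ (- p) * (`|A| + `|D|) `^ p.
  move=> uAD; rewrite powRN -powR_inv1 ?powR_ge0 // powRAC powR_inv1 //.
  rewrite -powRM ?addr_ge0 // ge0_ler_powR // ?nnegrE ?mulr_ge0 ?addr_ge0 //.
  by rewrite normrM mulrC normfV normr_nat ler_wpM2l.
have := lerD (half (A + D) (ler_normD _ _)) (half (A - D) (ler_normB _ _)).
move/le_trans; apply.
have -> : 2 `^ (1 - p) = 2 * 2 `^ (- p) :> R.
  by rewrite powRD ?powRr1 // pnatr_eq0 implybT.
rewrite -mulr2n -mulrnAl -mulr_natl ler_wpM2l ?mulr_ge0 ?powR_ge0 //.
exact: powR_add_le.
Qed.

(** By the parallelogram law, halving the mesh halves the quadratic variation
and adds half the sum of the squared midpoint excesses; the factors 2^n turn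
this recursion into a telescoping sum. *)
Lemma pvariation2E (R : realType) (x : R -> R) n :
  2 ^+ n * pvariation x 2 n =
  (x 1 - x 0) ^+ 2 + \sum_(0 <= m < n) \sum_(0 <= k < 2 ^ m) fs_coef x m k ^+ 2.
Proof.
elim: n => [|n IH].
  rewrite big_geq // addr0 expr0 mul1r /pvariation expn0 big_nat1.
  rewrite expr0 !divr1 mulr0n.
  by rewrite powR_mulrn // real_normK // num_real.
rewrite big_nat_recr //= addrA -IH pvariation_refine.
rewrite (_ : pvariation x 2 n = \sum_(0 <= k < 2 ^ n) `|increment x n k| `^ 2) //.
rewrite !mulr_sumr -big_split /=; apply: eq_bigr => k _.
rewrite !powR_mulrn // !real_normK ?num_real // fs_coefE (exprMn _ (2 `^ _)).
have -> : (2 `^ (n%:R / 2)) ^+ 2 = 2 ^+ n :> R.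
  by rewrite -powR_mulrn ?powR_ge0 // -powRrM divfK ?pnatr_eq0 // powR_mulrn.
by rewrite exprS; field.
Qed.
(** * Sums of consecutive tents *)

Lemma fs00_ge0 (R : realType) (t : R) : 0 <= fs00 t.
Proof. by rewrite /fs00 le_max lexx orbT. Qed.

Lemma fs00_le_half (R : realType) (t : R) : fs00 t <= 2^-1.
Proof.
rewrite /fs00 ge_max invr_ge0 ler0n andbT ge_min.
by have [//|] := leP t 2^-1; lra.
Qed.

Lemma fs00_eq0l (R : realType) (t : R) : t <= 0 -> fs00 t = 0.
Proof.
move=> t0; rewrite /fs00; apply/max_idPr.
by rewrite ge_min t0.
Qed.

Lemma fs00_eq0r (R : realType) (t : R) : 1 <= t -> fs00 t = 0.
Proof.
move=> t1; rewrite /fs00; apply/max_idPr.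
by rewrite ge_min subr_le0 t1 orbT.
Qed.

Lemma fs00_left (R : realType) (t : R) : 0 <= t <= 2^-1 -> fs00 t = t.
Proof.
move=> t01; rewrite /fs00.
by rewrite (min_idPl _) ?(max_idPl _) //; lra.
Qed.

Lemma fs00_right (R : realType) (t : R) : 2^-1 <= t <= 1 -> fs00 t = 1 - t.
Proof.
move=> t01; rewrite /fs00.
by rewrite (min_idPr _) ?(max_idPl _) //; lra.
Qed.

(** The tent is affine between consecutive breakpoints 0, 1/2 and 1; the
hypotheses say that none of them lies strictly between u and v. *)
Lemma fs00_midpoint (R : realType) (u v : R) : u <= v ->
  0 <= u \/ v <= 0 -> 2^-1 <= u \/ v <= 2^-1 -> 1 <= u \/ v <= 1 ->
  2 * fs00 ((u + v) / 2) = fs00 u + fs00 v.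
Proof.
move=> uv [u0|v0]; last by move=> _ _; rewrite !fs00_eq0l; lra.
move=> [uh|vh]; last by move=> _; rewrite !fs00_left; lra.
move=> [u1|v1]; first by rewrite !fs00_eq0r; lra.
by rewrite !fs00_right; lra.
Qed.

Lemma fs00_continuous (R : realType) : continuous (@fs00 R).
Proof.
move=> t.
apply: (@continuous_max R R (fun t => Num.min t (1 - t)) (cst 0)).
  apply: (@continuous_min R R id (fun t => 1 - t)); first exact: cvg_id.
  by apply: cvgB; [exact: cvg_cst|exact: cvg_id].
exact: cvg_cst.
Qed.

Definition tents {R : realType} (K : nat) (y : R) : R :=
  \sum_(0 <= k < K) fs00 (y - k%:R).

Lemma tents_ge0 (R : realType) K (y : R) : 0 <= tents K y.
Proof. by apply: sumr_ge0 => k _; exact: fs00_ge0. Qed.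

(** The supports of the tents are disjoint: when the last tent is active, all
the previous ones have ended. *)
Lemma tents_le_half (R : realType) K (y : R) : tents K y <= 2^-1.
Proof.
elim: K => [|K IH]; first by rewrite /tents big_geq // invr_ge0.
rewrite /tents big_nat_recr //= -/(tents K y).
have [yK|Ky] := leP y K%:R.
  by rewrite [fs00 _]fs00_eq0l ?addr0 // subr_le0.
rewrite {1}/tents big_nat big1 ?add0r ?fs00_le_half // => k /= kK.
rewrite fs00_eq0r // lerBrDl (le_trans _ (ltW Ky)) //.
by rewrite -[1]/(1%:R) -natrD ler_nat addn1.
Qed.

Lemma tents_nat (R : realType) K j : tents K j%:R = 0 :> R.
Proof.
rewrite /tents big1 // => k _; have [jk|kj] := leqP j k.
  by rewrite fs00_eq0l // subr_le0 ler_nat.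
by rewrite fs00_eq0r // lerBrDl -[1]/(1%:R) -natrD ler_nat addn1.
Qed.

Lemma tents_half (R : realType) K j :
  tents K (j%:R + 2^-1) = (j < K)%N%:R / 2 :> R.
Proof.
have far k : k != j -> fs00 (j%:R + 2^-1 - k%:R : R) = 0.
  rewrite neq_ltn => /orP[kj|jk].
  - have : k.+1%:R <= j%:R :> R by rewrite ler_nat.
    by rewrite -natr1 => ?; rewrite fs00_eq0r //; lra.
  - have : j.+1%:R <= k%:R :> R by rewrite ler_nat.
    by rewrite -natr1 => ?; rewrite fs00_eq0l //; lra.
rewrite /tents; have [jK|Kj] := ltnP j K.
- rewrite (bigD1_seq j) ?mem_index_iota ?iota_uniq //=.
  rewrite big1 => [|k /far //]; rewrite addr0 addrAC subrr add0r.
  by rewrite fs00_left; lra.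
- rewrite mul0r big_nat big1 // => k /= kK; apply: far; lia.
Qed.

(** The half-integers are the breakpoints of the translated tents, and they all
lie on the dyadic grids of mesh at most 1/2. *)
Lemma dyadic_cell_avoids (R : realType) d j h :
  h%:R / 2 <= j%:R / 2 ^+ d.+1 :> R \/ j.+1%:R / 2 ^+ d.+1 <= h%:R / 2 :> R.
Proof.
have p2 : 0 < 2 ^+ d.+1 :> R by rewrite exprn_gt0.
have E : h%:R / 2 = (h * 2 ^ d)%:R / 2 ^+ d.+1 :> R.
  by rewrite natrM natrX exprS invfM mulrACA divff ?mulr1 // expf_neq0 // pnatr_eq0.
rewrite E !ler_pM2r ?invr_gt0 // !ler_nat.
by have [|] := leqP (h * 2 ^ d) j; [left|right].
Qed.

(** A sum of tents is affine on each dyadic interval of length at most 1/2. *)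
Lemma tents_midpoint (R : realType) K d j :
  2 * tents K ((2 * j + 1)%:R / 2 ^+ d.+2) =
  tents K (j%:R / 2 ^+ d.+1) + tents K (j.+1%:R / 2 ^+ d.+1) :> R.
Proof.
rewrite /tents mulr_sumr -big_split /=; apply: eq_bigr => k _.
set u := j%:R / _; set v := j.+1%:R / _.
have -> : (2 * j + 1)%:R / 2 ^+ d.+2 - k%:R =
    ((u - k%:R) + (v - k%:R)) / 2 :> R.
  rewrite /u /v natrD natrM -[j.+1%:R]natr1 exprS.
  by field; rewrite expf_neq0 // pnatr_eq0.
have p2 : 0 < 2 ^+ d.+1 :> R by rewrite exprn_gt0.
apply: fs00_midpoint.
- by rewrite lerD2r /u /v ler_pM2r ?invr_gt0 // ler_nat.
- have := dyadic_cell_avoids R d j (2 * k)%N; rewrite -/u -/v natrM; lra.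
- have := dyadic_cell_avoids R d j (2 * k + 1)%N.
  rewrite -/u -/v natrD natrM; lra.
- have := dyadic_cell_avoids R d j (2 * k + 2)%N.
  rewrite -/u -/v natrD natrM; lra.
Qed.

Lemma tents_continuous (R : realType) K : continuous (@tents R K).
Proof.
elim: K => [|K IH] y.
  rewrite (_ : @tents R 0 = cst 0); first exact: cvg_cst.
  by apply/funext => u; rewrite /tents big_geq.
rewrite (_ : tents K.+1 = fun u : R => tents K u + fs00 (u - K%:R)); last first.
  by apply/funext => u; rewrite /tents big_nat_recr.
apply: cvgD; first exact: IH.
apply: (@continuous_comp _ _ _ (fun u : R => u - K%:R) (@fs00 R)).
  by apply: cvgB; [exact: cvg_id|exact: cvg_cst].
exact: fs00_continuous.
Qed.

(** * The sparse Faber-Schauder series *)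

Definition sparse_count {R : realType} (alpha : R) m : nat :=
  Num.truncn (2 `^ (alpha * m%:R)).

Lemma sparse_fs_termE (R : realType) (alpha rho t : R) m :
  sparse_fs_term alpha rho t m =
  (2 `^ (- (alpha * rho))) ^+ m * tents (sparse_count alpha m) (2 ^+ m * t).
Proof.
rewrite /sparse_fs_term /tents !mulr_sumr; apply: eq_bigr => k _.
rewrite /fs mulrA -powRD ?pnatr_eq0 ?implybT //.
rewrite -[in RHS]powR_mulrn ?powR_ge0 // -powRrM; congr (2 `^ _ * _).
lra.
Qed.

(** Tents vanish at the integers, so the levels from n on do not contribute at
the dyadic points of order n. *)
Lemma sparse_fs_dyadic (R : realType) (alpha rho : R) n j :
  sparse_fs alpha rho (j%:R / 2 ^+ n) =
  \sum_(0 <= m < n) sparse_fs_term alpha rho (j%:R / 2 ^+ n) m.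
Proof.
rewrite /sparse_fs; apply: cvg_lim => //.
apply: cvg_near_cst; exists n => // N /= nN.
rewrite /series /= (@big_cat_nat _ _ _ n) //= [X in _ + X]big_nat.
rewrite [X in _ + X]big1 ?addr0 // => m /andP[nm _].
rewrite sparse_fs_termE.
rewrite (_ : 2 ^+ m * (j%:R / 2 ^+ n) = (2 ^ (m - n) * j)%:R) ?tents_nat ?mulr0 //.
rewrite natrM natrX -{1}(subnK nm) exprD; field.
by rewrite expf_neq0 // pnatr_eq0.
Qed.

(** Only level n is seen: higher levels vanish at the three points, and lower
ones are affine between them. *)
Lemma midpoint_excess_sparse_fs (R : realType) (alpha rho : R) n k :
  midpoint_excess (sparse_fs alpha rho) n k =
  if (k < sparse_count alpha n)%N then (2 `^ (- (alpha * rho))) ^+ n else 0.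
Proof.
rewrite /midpoint_excess -(dyadic_refine R n k) -(dyadic_refine R n k.+1).
rewrite !sparse_fs_dyadic mulr_sumr -!sumrB big_nat_recr //=.
rewrite big_nat big1 ?add0r => [|m /= mn].
  rewrite !dyadic_refine !sparse_fs_termE.
  have p2 : 2 ^+ n != 0 :> R by rewrite expf_neq0 // pnatr_eq0.
  rewrite ![2 ^+ n * (_ / 2 ^+ n)]mulrC !divfK // !tents_nat !mulr0 !subr0.
  have -> : 2 ^+ n * ((2 * k + 1)%:R / 2 ^+ n.+1) = k%:R + 2^-1 :> R.
    by rewrite natrD natrM exprS; field.
  rewrite tents_half; case: ifP => _ /=; first by rewrite mulr1n; field.
  by rewrite mul0r !mulr0.
have [d nE] : exists d, n = (m + d.+1)%N by exists (n - m).-1; lia.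
rewrite !dyadic_refine !sparse_fs_termE nE.
have p2 e : 2 ^+ e != 0 :> R by rewrite expf_neq0 // pnatr_eq0.
have cell (y : R) e : 2 ^+ m * (y / 2 ^+ (m + e)) = y / 2 ^+ e.
  by rewrite exprD; field; rewrite !p2.
rewrite -addnS !cell mulrCA tents_midpoint; ring.
Qed.
Lemma sparse_count_le (R : realType) (alpha : R) m :
  (sparse_count alpha m)%:R <= (2 `^ alpha) ^+ m :> R.
Proof.
by rewrite -powR_expr /sparse_count; have /andP[] := truncn_itv (powR_ge0 2 (alpha * m%:R)).
Qed.

Lemma sparse_count_gt (R : realType) (alpha : R) m :
  (2 `^ alpha) ^+ m - 1 < (sparse_count alpha m)%:R :> R.
Proof.
rewrite -powR_expr /sparse_count ltrBlDr natr1.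
by have /andP[] := truncn_itv (powR_ge0 2 (alpha * m%:R)).
Qed.

Lemma sparse_count_ge_half (R : realType) (alpha : R) m : 0 <= alpha ->
  (2 `^ alpha) ^+ m / 2 <= (sparse_count alpha m)%:R :> R.
Proof.
move=> a0; have gt := sparse_count_gt R alpha m.
have ge1 : 1 <= (sparse_count alpha m)%:R :> R.
  rewrite ler1n truncn_gt0 -[leLHS](powRr0 2) ler_powR ?ler1n //.
  by rewrite mulr_ge0.
lra.
Qed.

Lemma sparse_count_le_expn (R : realType) (alpha : R) m : alpha <= 1 ->
  (sparse_count alpha m <= 2 ^ m)%N.
Proof.
move=> a1; rewrite -(ler_nat R) natrX; apply: le_trans (sparse_count_le _ _ _) _.
by rewrite lerXn2r ?nnegrE ?powR_ge0 // ler1_powR ?ler1n.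
Qed.

Lemma sum_midpoint_excess_sparse_fs (R : realType) (alpha rho : R)
    (F : R -> R) n : alpha <= 1 -> F 0 = 0 ->
  \sum_(0 <= k < 2 ^ n) F (midpoint_excess (sparse_fs alpha rho) n k) =
  (sparse_count alpha n)%:R * F ((2 `^ (- (alpha * rho))) ^+ n).
Proof.
move=> a1 F0; have Kn := sparse_count_le_expn R alpha n a1.
rewrite (@big_cat_nat _ _ _ (sparse_count alpha n)) //= addrC.
rewrite big_nat big1 ?add0r => [|k /andP[Kk _]]; last first.
  by rewrite midpoint_excess_sparse_fs ltnNge Kk.
rewrite (eq_big_nat _ _ (F2 := fun=> F ((2 `^ (- (alpha * rho))) ^+ n))).
  by rewrite sumr_const_nat subn0 mulr_natl.
by move=> k /andP[_ kK]; rewrite midpoint_excess_sparse_fs kK.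
Qed.

(** * Roughness exponent, quadratic variation and estimator of the series *)

Section SparseFS.
Context {R : realType} (alpha rho : R).
Hypotheses (alpha01 : 0 < alpha <= 1) (rho01 : 0 < rho < 1).

Let alpha_gt0 : 0 < alpha. Proof. by case/andP: alpha01. Qed.
Let alpha_le1 : alpha <= 1. Proof. by case/andP: alpha01. Qed.
Let rho_gt0 : 0 < rho. Proof. by case/andP: rho01. Qed.
Let rho_lt1 : rho < 1. Proof. by case/andP: rho01. Qed.

Let ratio : R := 2 `^ (- (alpha * rho)).

Let ratio_itv : 0 < ratio < 1.
Proof. by apply: pow2_lt1; rewrite oppr_lt0 mulr_gt0. Qed.

Lemma sparse_fs_term_le m t : `|sparse_fs_term alpha rho t m| <= ratio ^+ m.
Proof.
have /andP[r0 _] := ratio_itv.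
rewrite sparse_fs_termE -/ratio ger0_norm ?mulr_ge0 ?tents_ge0 ?exprn_ge0 ?(ltW r0) //.
rewrite ler_piMr ?exprn_ge0 ?(ltW r0) // (le_trans (tents_le_half _ _ _)) //.
by rewrite invf_le1 ?ler1n.
Qed.

Lemma sparse_fs_cvg t : cvgn (series (sparse_fs_term alpha rho t)).
Proof.
exact: (geometric_series_cvg _ _ (fun m t => sparse_fs_term alpha rho t m)
  ratio ratio_itv sparse_fs_term_le).
Qed.

Lemma sparse_fs_continuous : continuous (sparse_fs alpha rho).
Proof.
apply: (geometric_series_continuous _ _ (fun m t => sparse_fs_term alpha rho t m)
  ratio ratio_itv sparse_fs_term_le) => m t.
rewrite (_ : (fun t => _) =
    (fun t => ratio ^+ m * tents (sparse_count alpha m) (2 ^+ m * t))).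
  apply: cvgMl_tmp.
  apply: (@continuous_comp _ _ _ (fun t : R => 2 ^+ m * t)); last exact: tents_continuous.
  by apply: cvgMl_tmp; exact: cvg_id.
by apply/funext => u; rewrite sparse_fs_termE.
Qed.

Lemma sparse_fs_nat j : sparse_fs alpha rho j%:R = 0.
Proof.
by have := sparse_fs_dyadic R alpha rho 0 j; rewrite expr0 divr1 big_geq.
Qed.

Lemma sparse_fs_half : sparse_fs alpha rho 2^-1 = 2^-1.
Proof.
have := midpoint_excess_sparse_fs R alpha rho 0 0.
rewrite /midpoint_excess /sparse_count mulr0 powRr0 truncn1 /= !expr0 !divr1.
rewrite !sparse_fs_nat !subr0 muln0 add0n expr1 mul1r.
lra.
Qed.

(** The exponent of the driving term is alpha (1 - rho p) < 0, and p > 1 leaves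
room for a contraction factor below 1 in [pvariation_le]. *)
Lemma sparse_fs_pvariation_cvg0 p : rho^-1 < p ->
  pvariation (sparse_fs alpha rho) p n @[n --> \oo] --> (0 : R).
Proof.
move=> rp; have p1 : 1 < p by apply: lt_trans rp; rewrite invf_gt1.
have p0 : 0 < p by lra.
have rp1 : 1 < rho * p by rewrite -ltr_pdivrMl // mulr1.
(* This s gives 2 ^ (1 - p) * (1 + s) ^ p = 2 ^ ((1 - p) / 2) < 1. *)
pose s : R := 2 `^ ((1 - p^-1) / 2) - 1.
have s0 : 0 < s.
  by rewrite subr_gt0 pow2_gt1 // divr_gt0 // subr_gt0 invf_lt1.
pose c : R := 2 `^ (1 - p) * (1 + s^-1) `^ p.
pose z : R := 2 `^ (alpha * (1 - rho * p)).
have c0 : 0 <= c by rewrite mulr_ge0 ?powR_ge0.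
have rec n : pvariation (sparse_fs alpha rho) p n.+1 <=
    2 `^ ((1 - p) / 2) * pvariation (sparse_fs alpha rho) p n + c * z ^+ n.
  apply: le_trans (pvariation_le _ _ _ _ n (ltW p0) s0) _.
  rewrite mulrDr; apply: lerD; rewrite mulrA.
    apply: ler_wpM2r (pvariation_ge0 _ _ _ _) _ _ _.
    rewrite /s subrKC -powRrM -pow2D ler_powR ?ler1n //.
    by rewrite le_eqVlt; apply/orP; left; apply/eqP; field; lra.
  apply: ler_wpM2l c0 _ _ _.
  rewrite (sum_midpoint_excess_sparse_fs R alpha rho (fun u => `|u| `^ p)) //; last first.
    by rewrite normr0 powR0 // gt_eqF.
  rewrite ger0_norm ?exprn_ge0 ?powR_ge0 //.
  apply: le_trans (ler_wpM2r (powR_ge0 _ _) (sparse_count_le R alpha n)) _.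
  rewrite -!powR_expr -powRrM -pow2D ler_powR ?ler1n //.
  by rewrite le_eqVlt; apply/orP; left; apply/eqP; ring.
have := pvariation_ge0 R (sparse_fs alpha rho) p.
move: (pvariation _ p) rec => v rec v_ge0.
apply: (@contraction_cvg0 _ _ (fun n => c * z ^+ n) (2 `^ ((1 - p) / 2))).
- have /andP[/ltW -> ->] // : 0 < (2 `^ ((1 - p) / 2) : R) < 1.
  by apply: pow2_lt1; lra.
- by move=> n; rewrite !ger0_norm.
- rewrite -(mulr0 c); apply: cvgMl_tmp; apply: cvg_expr.
  have /andP[z0 z1] : 0 < z < 1.
    by apply: pow2_lt1; rewrite pmulr_rlt0 // subr_lt0.
  by rewrite gtr0_norm.
Qed.

(** A single level suffices: its K_n tents of height r^n / 2 already contribute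
of the order of 2^(n alpha (1 - rho p)). *)
Lemma sparse_fs_pvariation_cvgy p : 0 < p -> p < rho^-1 ->
  pvariation (sparse_fs alpha rho) p n @[n --> \oo] --> +oo.
Proof.
move=> p0 pr; have rp1 : rho * p < 1 by rewrite -ltr_pdivlMl // mulr1.
pose z : R := 2 `^ (alpha * (1 - rho * p)).
have z1 : 1 < z by apply: pow2_gt1; rewrite mulr_gt0 // subr_gt0.
rewrite -cvg_shiftS.
apply: (@ger_cvgy _ _ _ _ (fun n => z ^+ n * (2^-1 * 2^-1 `^ p))).
  apply: nearW => n; apply: le_trans (pvariation_ge _ _ _ n (ltW p0)).
  rewrite (sum_midpoint_excess_sparse_fs R alpha rho (fun u => `|u / 2| `^ p)) //; last first.
    by rewrite mul0r normr0 powR0 // gt_eqF.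
  rewrite ger0_norm ?divr_ge0 ?exprn_ge0 ?powR_ge0 //.
  rewrite powRM ?exprn_ge0 ?powR_ge0 // [leLHS]mulrA [leRHS]mulrA ler_wpM2r ?powR_ge0 //.
  apply: le_trans (ler_wpM2r (powR_ge0 _ _) (sparse_count_ge_half R alpha n (ltW alpha_gt0))).
  rewrite mulrAC ler_wpM2r // -!powR_expr -powRrM -pow2D ler_powR ?ler1n //.
  by rewrite le_eqVlt; apply/orP; left; apply/eqP; ring.
have c0 : 0 < 2^-1 * 2^-1 `^ p :> R by rewrite mulr_gt0 ?powR_gt0.
move/cvgryPge: (expr_cvgy R z z1) => zy; apply/cvgryPge => A.
by have := zy (A / (2^-1 * 2^-1 `^ p)); apply: filterS => n; rewrite ler_pdivrMr.
Qed.

Lemma sparse_fs_admits_roughness_exponent :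
  admits_roughness_exponent (sparse_fs alpha rho) rho.
Proof.
split.
- exact/continuous_subspaceT/sparse_fs_continuous.
- exists 0, 2^-1; rewrite !in_itv /= !lexx ler01 invr_ge0 ler0n invf_le1 ?ler1n //.
  split=> //; rewrite (sparse_fs_nat 0) sparse_fs_half eq_sym invr_eq0 pnatr_eq0 //.
- have rho_neq0 : rho != 0 by rewrite gt_eqF.
  exists (rho^-1)%:E; split.
  + by rewrite lee_fin invf_ge1 // ltW.
  + by rewrite inver invr_eq0 (negbTE rho_neq0) invrK.
  + by move=> p _; rewrite lte_fin; exact: sparse_fs_pvariation_cvg0.
  + by move=> p p0; rewrite lte_fin; exact: sparse_fs_pvariation_cvgy.
Qed.

Let energy n : R :=
  \sum_(0 <= m < n) \sum_(0 <= k < 2 ^ m) fs_coef (sparse_fs alpha rho) m k ^+ 2.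

Let gamma : R := alpha * rho + (1 - alpha) / 2.
Let growth : R := 2 `^ (2 - 2 * gamma).

Let growth_gt1 : 1 < growth.
Proof.
apply: pow2_gt1; rewrite /gamma.
have : alpha * rho < alpha by rewrite gtr_pMr.
by move: alpha_le1; lra.
Qed.

Lemma sparse_fs_energyS n : energy n.+1 =
  energy n + (sparse_count alpha n)%:R / (2 `^ alpha) ^+ n * growth ^+ n.
Proof.
rewrite /energy big_nat_recr //=; congr (_ + _).
rewrite (sum_midpoint_excess_sparse_fs R alpha rho
  (fun u => (2 `^ (n%:R / 2) * u) ^+ 2)) //; last by rewrite mulr0 expr0n.
rewrite -mulrA; congr (_ * _).
rewrite -!powR_expr -pow2D -powR_mulrn ?powR_ge0 // -powRrM -powRN -pow2D.
by congr (2 `^ _); rewrite /gamma; field.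
Qed.

(** The normalised energy u satisfies u_(n+1) = (u_n + kappa_n) / growth, where
|kappa_n - 1| <= 2^(- alpha n) because truncation loses less than 1. *)
Lemma sparse_fs_energy_cvg :
  energy n / growth ^+ n @[n --> \oo] --> (growth - 1)^-1.
Proof.
have w1 := growth_gt1; have w0 : 0 < growth by apply: lt_trans w1.
have A1 : 1 < 2 `^ alpha :> R by exact: pow2_gt1.
have A0 : 0 < 2 `^ alpha :> R by apply: lt_trans A1.
apply/subr_cvg0.
apply: (@contraction_cvg0 _ _ (fun n => growth^-1 * (2 `^ alpha)^-1 ^+ n) growth^-1).
- by rewrite invr_ge0 ltW //= invf_lt1.
- move=> n; pose kappa : R := (sparse_count alpha n)%:R / (2 `^ alpha) ^+ n.
  have -> : energy n.+1 / growth ^+ n.+1 - (growth - 1)^-1 =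
      growth^-1 * (energy n / growth ^+ n - (growth - 1)^-1) +
      growth^-1 * (kappa - 1).
    rewrite sparse_fs_energyS -/kappa exprS; field.
    by rewrite expf_neq0 ?gt_eqF //= subr_gt0.
  apply: le_trans (ler_normD _ _) _.
  rewrite !normrM ger0_norm ?invr_ge0 ?(ltW w0) // lerD2l.
  rewrite ler_wpM2l ?invr_ge0 ?(ltW w0) // exprVn.
  have An : 0 < (2 `^ alpha) ^+ n :> R by rewrite exprn_gt0.
  have le := sparse_count_le R alpha n; have gt := sparse_count_gt R alpha n.
  rewrite ler0_norm ?opprB.
    rewrite /kappa -[X in X - _](divff (lt0r_neq0 An)) -mulrBl.
    by rewrite ler_piMl ?invr_ge0 ?(ltW An) //; lra.
  by rewrite subr_le0 /kappa ler_pdivrMr // mul1r.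
- rewrite -(mulr0 growth^-1); apply: cvgMl_tmp; apply: cvg_expr.
  by rewrite gtr0_norm ?invr_gt0 // invf_lt1.
Qed.

Lemma sparse_fs_quadratic_variation_cvg :
  2 `^ (n%:R * (2 * gamma - 1)) * pvariation (sparse_fs alpha rho) 2 n
    @[n --> \oo] --> (growth - 1)^-1.
Proof.
rewrite (_ : (fun n => _) = (fun n => energy n / growth ^+ n)).
  exact: sparse_fs_energy_cvg.
apply/funext => n; have := pvariation2E R (sparse_fs alpha rho) n.
rewrite (sparse_fs_nat 1) (sparse_fs_nat 0) subrr expr0n add0r -/(energy n) => <-.
rewrite mulrAC; congr (_ * _).
rewrite -powR_mulrn // -powR_expr -powRN -pow2D.
by congr (2 `^ _); ring.
Qed.

Lemma sparse_fs_roughness_estimator_cvg :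
  roughness_estimator (sparse_fs alpha rho) n @[n --> \oo] --> gamma.
Proof.
have L0 : 0 < (growth - 1)^-1 by rewrite invr_gt0 subr_gt0 growth_gt1.
have u_cvg := sparse_fs_energy_cvg.
pose u n := energy n / growth ^+ n.
have ln2 : 0 < ln 2 :> R by rewrite ln_gt0 // ltr1n.
have w0 : 0 < growth by apply: lt_trans growth_gt1.
have lnu_cvg : ln (u n) @[n --> \oo] --> ln (growth - 1)^-1.
  by apply: continuous_cvg; [exact: continuous_ln|exact: u_cvg].
(* For large n the estimator is exactly gamma minus this correction, since
   log2 of growth ^ n is n times 2 - 2 gamma. *)
have lim : gamma - n%:R^-1 * (ln (u n) / 2 / ln 2) @[n --> \oo] --> gamma.
  rewrite -[X in _ --> X]subr0 -(mul0r (ln (growth - 1)^-1 / 2 / ln 2)).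
  apply: cvgB; first exact: cvg_cst.
  apply: cvgM.
    apply/(gtr0_cvgV0 _).2; last exact: cvgr_idn.
    by near=> n; rewrite ltr0n; near: n; exists 1%N.
  exact: cvgMr_tmp (cvgMr_tmp lnu_cvg).
apply: cvg_trans lim; apply: near_eq_cvg.
have u_gt0 : \forall n \near \oo, 0 < u n by exact: (cvgr_gt _ u_cvg _ L0).
near=> n.
have un : 0 < u n by near: n; exact: u_gt0.
have n0 : 0 < n%:R :> R by rewrite ltr0n; near: n; exists 1%N.
rewrite /roughness_estimator /fs_norm -/(energy n) /log2.
have En : energy n = u n * growth ^+ n.
  by rewrite /u divfK // expf_neq0 // gt_eqF.
have E0 : 0 < energy n by rewrite En mulr_gt0 // exprn_gt0.
rewrite -powR12_sqrt ?(ltW E0) // ln_powR En lnM ?posrE ?exprn_gt0 //.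
rewrite lnXn // ln_powR -mulr_natr; field.
by rewrite !gt_eqF.
Unshelve. all: by end_near. Qed.

End SparseFS.

Theorem proposition4p4 (R : realType) (alpha rho : R)
    (halpha : 0 < alpha <= 1) (hrho : 0 < rho < 1) :
  let x : R -> R := sparse_fs alpha rho in
  let gamma : R := alpha * rho + (1 - alpha) / 2 in
  [/\ forall t : R, t \in `[0, 1] -> cvgn (series (sparse_fs_term alpha rho t)),
      admits_roughness_exponent x rho,
      2 `^ (n%:R * (2 * gamma - 1)) * pvariation x 2 n @[n --> \oo]
        --> (2 `^ (2 - 2 * gamma) - 1)^-1
    & roughness_estimator x n @[n --> \oo] --> gamma].
Proof.
split.
- by move=> t _; exact: sparse_fs_cvg.
- exact: sparse_fs_admits_roughness_exponent.
- exact: sparse_fs_quadratic_variation_cvg.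
- exact: sparse_fs_roughness_estimator_cvg.
Qed.
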